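(* Let $c\in\mathbb{Q}^{r}$, $A\in\mathbb{Q}^{m\times r}$, $a\in\mathbb{Q}^{m}$ with $a_j\in[-1,1]$ for all $j=1,\dots,m$, and suppose the 0-1 integer linear program $$(\mathrm{C})\qquad \min_{z}\{c^{\top}z : Az\ge a,\ z\in\{0,1\}^{r}\}$$ has at least one feasible solution. For a real number $M$ consider the bilevel linear program with the single upper-level variable $\theta\in\mathbb{R}$ $$(\mathrm{C_{single}})\qquad \min_{\theta,z,f,s,t,u,e}\{c^{\top}z+Me : (z,f,s,t,u,e)\in\mathcal{S}(\mathrm{C^{low}_{single}}(\theta))\},$$ where $(\mathrm{C^{low}_{single}}(\theta))$ is the linear program defined in the context. Then one can compute a penalty coefficient $M$, of binary encoding size polynomial in the encoding size of $(\mathrm{C})$, such that the optimal objective values satisfy $v(\mathrm{C})=v(\mathrm{C_{single}})$; in fact, $$\mathcal{S}(\mathrm{C_{single}})=\{(\theta,z,f,s,t,u,e)\in\mathcal{F}(\mathrm{C_{single}}) : z\in\mathcal{S}(\mathrm{C})\}.$$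
   Context: For an optimization problem $P$, $v(P)$, $\mathcal{F}(P)$, $\mathcal{S}(P)$ denote its optimal objective value, set of feasible solutions and set of optimal solutions. For a bilevel program, the feasible set is the set of points whose lower-level part is optimal for the lower-level problem given the upper-level variable. $\mathbf{1}$ is the all-ones vector. For $\theta\in\mathbb{R}$ let $\mathcal{L}_r(\theta)$ be the set of $(z,f,s,t,u)$, each in $\mathbb{R}^{r}$, satisfying: $u_{r}=\theta$; for all $i=1,\dots,r$: $s_i\ge\tfrac32u_i-\tfrac12$, $t_i\ge\tfrac32u_i-1$, $z_i=2(s_i-t_i)$, $-f_i\le z_i-\tfrac12\le f_i$, $0\le z_i,f_i,s_i,t_i,u_i\le1$; and $u_{i-1}=3u_i-2z_i$ for all $i=2,\dots,r$. $(\mathrm{C^{low}_{single}}(\theta))$ is the linear program in $z,f,s,t,u\in\mathbb{R}^r$, $e\in\mathbb{R}$: $$\min\ \sum_{i=1}^{r}16^i(s_i+t_i)+\sum_{i=1}^{r}\frac{1}{4^{r-i}}f_i$$ subject to $Az+e\mathbf{1}\ge a$; $f_i+e\ge\tfrac12$ for all $i=1,\dots,r$; $0\le\theta\le1$; $0\le e\le1$; $(z,f,s,t,u)\in\mathcal{L}_r(\theta)$.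
   Formalization: The solution-set identity is proved with the extra condition e = 0 on the right-hand side: S(C_single) = {points of F(C_single) with z in S(C) and e = 0}; without it the identity fails, since the lower level leaves e free when z is binary. *)

(* Defs.v *)
From HB Require Import structures.
From mathcomp Require Import all_boot all_order all_algebra.
From mathcomp Require Import classical_sets reals ereal constructive_ereal.

Set Implicit Arguments.
Unset Strict Implicit.
Unset Printing Implicit Defensive.

Import Order.TTheory GRing.Theory Num.Theory.

Local Open Scope classical_set_scope.
Local Open Scope ring_scope.

Record minProblem (R : realType) (X : Type) := MinProblem {
  feasible : set X;
  objective : X -> R }.

(* v(P), with the convention v(P) = +oo if P is infeasible *)
Definition optval (R : realType) (X : Type) (P : minProblem R X) : \bar R :=
  ereal_inf [set (objective P x)%:E | x in feasible P].

Definition optsol (R : realType) (X : Type) (P : minProblem R X) : set X :=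
  [set x | feasible P x /\
           forall y, feasible P y -> objective P x <= objective P y].

Section Programs.
Variables (R : realType) (r m : nat).

Definition binaryProgram (c : 'cV[R]_r) (A : 'M[R]_(m, r)) (a : 'cV[R]_m) :
    minProblem R 'cV[R]_r :=
  MinProblem
    [set z | (forall j, a j 0 <= (A *m z) j 0) /\
             (forall i, z i 0 = 0 \/ z i 0 = 1)]
    (fun z => (c^T *m z) 0 0).

(* Ordinals count from 0: the index i = 1, ..., r of the mathematical text is
   the ordinal of value i - 1. *)
Definition Lset (theta : R) (z f s t u : 'cV[R]_r) : Prop :=
  [/\ forall i : 'I_r, i.+1 = r -> u i 0 = theta,
      forall i : 'I_r,
        [/\ 3 / 2 * u i 0 - 1 / 2 <= s i 0,
            3 / 2 * u i 0 - 1 <= t i 0,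
            z i 0 = 2 * (s i 0 - t i 0) &
            - f i 0 <= z i 0 - 1 / 2 <= f i 0],
      forall i : 'I_r,
        [/\ 0 <= z i 0 <= 1, 0 <= f i 0 <= 1, 0 <= s i 0 <= 1,
            0 <= t i 0 <= 1 & 0 <= u i 0 <= 1] &
      forall i j : 'I_r, j = i.+1 :> nat -> u i 0 = 3 * u j 0 - 2 * z j 0].

Record lowerVars := LowerVars {
  zv : 'cV[R]_r; fv : 'cV[R]_r; sv : 'cV[R]_r; tv : 'cV[R]_r; uv : 'cV[R]_r;
  ev : R }.

Definition lowerFeasible (A : 'M[R]_(m, r)) (a : 'cV[R]_m) (theta : R) :
    set lowerVars :=
  [set y | [/\ forall j, a j 0 <= (A *m zv y + const_mx (ev y)) j 0,
               forall i, 1 / 2 <= fv y i 0 + ev y,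
               0 <= theta <= 1,
               0 <= ev y <= 1 &
               Lset theta (zv y) (fv y) (sv y) (tv y) (uv y)]].

Definition lowerObjective (y : lowerVars) : R :=
  \sum_(i < r) 16 ^+ i.+1 * (sv y i 0 + tv y i 0) +
  \sum_(i < r) 1 / 4 ^+ (r - i.+1) * fv y i 0.

Definition lowerProgram (A : 'M[R]_(m, r)) (a : 'cV[R]_m) (theta : R) :
    minProblem R lowerVars :=
  MinProblem (lowerFeasible A a theta) lowerObjective.

(* A point is (theta, (z, f, s, t, u, e)). *)
Definition singleProgram (c : 'cV[R]_r) (A : 'M[R]_(m, r)) (a : 'cV[R]_m)
    (M : R) : minProblem R (R * lowerVars) :=
  MinProblem
    [set x | optsol (lowerProgram A a x.1) x.2]
    (fun x => (c^T *m zv x.2) 0 0 + M * ev x.2).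

End Programs.

(* Binary encodings.  A natural number is written with its binary digits, least
   significant first, each preceded by the bit 1, and closed by the bit 0, so
   that the encoding is self-delimiting and of length twice the number of
   digits plus one. *)
Definition binary_digits (n : nat) : bitseq :=
  mkseq (fun i => odd (n %/ 2 ^ i)) (up_log 2 n.+1).

Definition enc_nat (n : nat) : bitseq :=
  rcons (flatten [seq [:: true; b] | b <- binary_digits n]) false.

Definition enc_rat (q : rat) : bitseq :=
  (q < 0) :: enc_nat `|numq q|%N ++ enc_nat `|denq q|%N.

Definition enc_mx (p q : nat) (B : 'M[rat]_(p, q)) : bitseq :=
  flatten [seq enc_rat (B ij.1 ij.2) | ij <- enum {: 'I_p * 'I_q}].

Definition enc_program (r m : nat) (c : 'cV[rat]_r) (A : 'M[rat]_(m, r))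
    (a : 'cV[rat]_m) : bitseq :=
  enc_nat r ++ enc_nat m ++ enc_mx c ++ enc_mx A ++ enc_mx a.

(* Deterministic Turing machines with one two-way infinite tape over the
   symbols 0, 1 and blank (None).  A transition gives the new state, the symbol
   written, and the move (true: right, false: left); no transition means that
   the machine halts. *)
Record turingMachine := TuringMachine {
  tm_state : finType;
  tm_start : tm_state;
  tm_next : tm_state -> option bool -> option (tm_state * option bool * bool) }.

(* (q, l, s): l is the tape to the left of the head, nearest cell first; s is
   the tape from the head on, scanned cell first; the cells beyond are blank. *)
Definition tm_config (T : turingMachine) : Type :=
  tm_state T * seq (option bool) * seq (option bool).

Definition tm_step (T : turingMachine) (x : tm_config T) :
    option (tm_config T) :=
  let: (q, l, s) := x in
  match tm_next q (head None s) with
  | None => None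
  | Some (q', b, true) => Some (q', b :: l, behead s)
  | Some (q', b, false) => Some (q', behead l, head None l :: b :: behead s)
  end.

(* Started on the leftmost bit of w, T halts on the leftmost bit of w', which is
   followed by blanks only. *)
Definition tm_computes (T : turingMachine) (w w' : bitseq) : Prop :=
  exists (n : nat) (q : tm_state T) (l s : seq (option bool)),
    [/\ iter n (obind (@tm_step T)) (Some (tm_start T, [::], map some w)) =
          Some (q, l, s),
        tm_step (q, l, s) = None &
        forall i, nth None s i = onth w' i].

(* Main.v *)
Require Import Defs.
From HB Require Import structures.
From mathcomp Require Import all_boot all_order all_algebra.
From mathcomp Require Import classical_sets reals ereal constructive_ereal.
From mathcomp Require Import ring lra zify.

Set Implicit Arguments.
Unset Strict Implicit.
Unset Printing Implicit Defensive.

Import Order.TTheory GRing.Theory Num.Theory.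

(* Raising e to 1 relaxes all constraints of the lower level program that link
   it to (C), so at a lower level optimum f_i = |z_i - 1/2|, and f_i + e >= 1/2
   puts z within e of a binary point z'.  Either z' is feasible for (C) and
   costs at most |c| e more than z, where |.| is the sum of the absolute values
   of the entries, or z' violates a row of A z' >= a, and then by at least 1/D
   for a common denominator D, which forces e >= 1 / ((|A| + 1) D).  So any
   M > |c| (|A| + 1) D with M > |c| is an exact penalty, and M = 2^n - 1 is large
   enough as soon as n exceeds half of the input size; a Turing machine writes
   this number in a single pass over its input.  Conversely a binary z is encoded
   in the ternary digits of theta, and the weights 16^i make the greedy values of
   s and t the lower level optimum. *)

Local Open Scope classical_set_scope.
Local Open Scope ring_scope.

(** * A Turing machine writing a number 2^n - 1 *)

Lemma cat_nseq_cons (T : Type) n (x : T) s :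
  nseq n x ++ x :: s = x :: nseq n x ++ s.
Proof. by elim: n => //= n ->. Qed.

Lemma binary_digits_pred_pow2 n : binary_digits (2 ^ n)%N.-1 = nseq n true.
Proof.
rewrite /binary_digits prednK ?expn_gt0// up_expnK//.
apply: (@eq_from_nth _ true) => [|i]; rewrite size_mkseq ?size_nseq// => ltin.
rewrite nth_mkseq// nth_nseq ltin.
(* Quotient and remainder of the division by 2^i; as i < n, the quotient 2^(n-i) - 1 is odd. *)
have -> : (2 ^ n).-1 = ((2 ^ (n - i)).-1 * 2 ^ i + (2 ^ i).-1)%N.
  have := expnD 2 (n - i) i; rewrite subnK ?(ltnW ltin)// => ->.
  have := expn_gt0 2 i; have := expn_gt0 2 (n - i); nia.
have e_gt0 : (0 < 2 ^ i)%N by rewrite expn_gt0.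
rewrite divnMDl// divn_small ?addn0; last by rewrite prednK.
have := expn_gt0 2 (n - i); case: (n - i)%N (subn_gt0 i n) => [|k _].
  by rewrite ltin.
rewrite expnS; move: (expn_gt0 2 k).
by case: (2 ^ k)%N => // l; rewrite mul2n doubleS /= odd_double.
Qed.

Lemma enc_rat_pred_pow2 n :
  enc_rat (2 ^ n)%N.-1%:R =
    false :: nseq n.*2 true ++ [:: false; true; true; false].
Proof.
rewrite /enc_rat; congr cons; first by apply/negbTE; rewrite -leNgt ler0n.
rewrite pmulrn numq_int denq_int /= /enc_nat.
rewrite binary_digits_pred_pow2 -cats1 -catA; congr cat.
by elim: n => //= n ->.
Qed.

(* After the first cell, which becomes the sign bit, the input is overwritten by
   the digits of the numerator, states 1 and 2 keeping track of parity; states 3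
   and 4 pad with further ones, states 5 to 8 write the end of the encoding
   (0 closes the numerator, 110 is the denominator 1), and state 9 rewinds. *)
Definition mersenne_next (q : 'I_11) (b : option bool) :
    option ('I_11 * option bool * bool) :=
  let goto k (ltk : (k < 11)%N) c d := Some (Ordinal ltk, c, d) in
  match val q, b with
  | 0, _ => goto 1 isT (Some false) true
  | 1, Some _ => goto 2 isT (Some true) true
  | 1, None => goto 4 isT (Some true) true
  | 2, Some _ => goto 1 isT (Some true) true
  | 2, None => goto 3 isT (Some true) true
  | 3, _ => goto 4 isT (Some true) true
  | 4, _ => goto 5 isT (Some true) true
  | 5, _ => goto 6 isT (Some false) true
  | 6, _ => goto 7 isT (Some true) true
  | 7, _ => goto 8 isT (Some true) true
  | 8, _ => goto 9 isT (Some false) false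
  | 9, Some _ => goto 9 isT b false
  | 9, None => goto 10 isT None true
  | _, _ => None
  end%N.

Definition mersenne_machine := TuringMachine (@Ordinal 11 0 isT) mersenne_next.

Local Notation steps n x := (iter n (obind (@tm_step mersenne_machine)) x).
Local Notation state k := (@Ordinal 11 k isT : tm_state mersenne_machine).

(** States 1 and 2 swap at every cell, so the induction carries both starting states at once. *)
Lemma mersenne_overwrite w l :
  steps (size w) (Some (state 1, l, map some w)) =
    Some (if odd (size w) then state 2 else state 1,
          nseq (size w) (Some true) ++ l, [::]) /\
  steps (size w) (Some (state 2, l, map some w)) =
    Some (if odd (size w) then state 1 else state 2,
          nseq (size w) (Some true) ++ l, [::]).
Proof.
elim: w l => [//|b w IHw] l; rewrite [size _]/= !iterSr.
have [IH1 IH2] := IHw (Some true :: l).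
rewrite [obind _ _]/= IH2 [obind _ _]/= IH1.
have -> : nseq (size w) (Some true) ++ Some true :: l =
          nseq (size w).+1 (Some true) ++ l by rewrite cat_nseq_cons.
by rewrite /=; case: (odd _).
Qed.

Lemma mersenne_rewind v b s :
  steps (size v).+1 (Some (state 9, map some v, Some b :: s)) =
    Some (state 9, [::], None :: catrev (map some v) (Some b :: s)).
Proof.
by elim: v b s => [//|x v IHv] b s; rewrite iterSr [obind _ _]/= IHv.
Qed.

Lemma mersenne_machine_computes w : (0 < size w)%N ->
  tm_computes mersenne_machine w (enc_rat (2 ^ (size w)./2.+1)%N.-1%:R).
Proof.
case: w => // b w _; set n := (size (b :: w))./2.+1; rewrite enc_rat_pred_pow2.
set ones := nseq n.*2 true.
have padded : exists k,
    steps k (Some (state 0, [::], map some (b :: w))) =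
    Some (state 5, map some (rcons ones false), [::]).
  (* One step for the sign bit, one per remaining cell, then two or three padding steps that make
     the number of ones even. *)
  exists ((if odd (size w) then 3 else 2) + (size w + 1))%N.
  rewrite !iterD [X in steps (size w) X]/= (mersenne_overwrite w _).1.
  rewrite map_rcons map_nseq -cats1.
  have -> : n.*2 = ((if odd (size w) then 3 else 2) + size w)%N.
    by rewrite /n /=; case: ifP; lia.
  by rewrite nseqD -catA; case: (odd _).
have [k padk] := padded.
pose v := [:: true, false & rcons ones false].
(* Read from the right: padding, four steps for the closing bits, the rewinding to the blank before
   the sign bit, and one step back. That blank is the final left tape. *)
exists (1 + ((size v).+1 + (4 + k)))%N, (state 10), [:: None].
exists (map some (false :: ones ++ [:: false; true; true; false])).
split=> //; last by move=> i; rewrite onthE.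
rewrite [tm_start _]/= !iterD padk.
have -> : steps 4 (Some (state 5, map some (rcons ones false), [::])) =
  Some (state 9, map some v, [:: Some true; Some false]) by [].
rewrite mersenne_rewind /= /tm_step /=.
congr (Some (_, _, _)).
rewrite catrevE -map_rev rev_rcons rev_nseq.
by rewrite /= !map_cat map_nseq /= !cat_nseq_cons.
Qed.

(** * Heights of rational matrices and encoding length *)

Definition num_height (p q : nat) (B : 'M[rat]_(p, q)) : nat :=
  \prod_(ij : 'I_p * 'I_q) `|numq (B ij.1 ij.2)|.+1%N.

Definition den_height (p q : nat) (B : 'M[rat]_(p, q)) : nat :=
  \prod_(ij : 'I_p * 'I_q) `|denq (B ij.1 ij.2)|%N.

Lemma size_enc_nat n : size (enc_nat n) = ((up_log 2 n.+1).*2.+1)%N.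
Proof.
rewrite /enc_nat size_rcons size_flatten /shape -map_comp.
rewrite -[up_log 2 n.+1](size_mkseq (fun i => odd (n %/ 2 ^ i))).
by rewrite /binary_digits; elim: (mkseq _ _) => //= b s; rewrite doubleS; lia.
Qed.

(** The square reflects that the encoding spends two bits on each binary digit. *)
Lemma height_enc_rat q :
  ((`|numq q|.+1 * `|denq q|) ^ 2 <= 2 ^ size (enc_rat q))%N.
Proof.
rewrite /enc_rat /= size_cat !size_enc_nat.
have num_le := up_logP `|numq q|.+1 (ltnSn 1).
have den_le := up_logP `|denq q|.+1 (ltnSn 1).
move: (up_log _ _) (up_log _ _) num_le den_le => l k num_le den_le.
apply: (@leq_trans ((2 ^ (k + l)) ^ 2)).
  by rewrite leq_exp2r// expnD leq_mul// ltnW.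
by rewrite -expnM leq_exp2l//; lia.
Qed.

Lemma height_enc_mx p q (B : 'M[rat]_(p, q)) :
  ((num_height B * den_height B) ^ 2 <= 2 ^ size (enc_mx B))%N.
Proof.
rewrite /num_height /den_height -big_split /= -[X in (X ^ 2)%N]big_enum.
rewrite /enc_mx; elim: (enum _) => [|ij s IHs]; first by rewrite big_nil.
rewrite big_cons map_cons -[flatten _]/(_ ++ flatten _) size_cat expnD.
rewrite expnMn leq_mul//.
exact: height_enc_rat.
Qed.

Lemma num_height_gt0 p q (B : 'M[rat]_(p, q)) : (0 < num_height B)%N.
Proof. by rewrite prodn_gt0. Qed.

Lemma den_height_gt0 p q (B : 'M[rat]_(p, q)) : (0 < den_height B)%N.
Proof. by apply: prodn_gt0 => ij; rewrite absz_gt0 denq_neq0. Qed.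

Lemma height_enc_program r m (c : 'cV[rat]_r) (A : 'M[rat]_(m, r))
    (a : 'cV[rat]_m) :
  (num_height c * (num_height A * (den_height A * den_height a)) <
     (2 ^ (size (enc_program c A a))./2.+1).-1)%N.
Proof.
set P := (X in (X < _)%N); set L := size _.
have P_gt0 : (0 < P)%N by rewrite !muln_gt0 !num_height_gt0 !den_height_gt0.
have leP : (P ^ 2 * 4 <= 2 ^ L)%N.
  rewrite /L /enc_program !size_cat !size_enc_nat.
  (* The encodings of [r] and [m] have at least one bit each, whence the factor 4; it later absorbs
     the bit lost in halving an odd [L]. *)
  apply: (@leq_trans (2 ^ (size (enc_mx c) + size (enc_mx A) +
                           size (enc_mx a)) * 2 ^ 2)); last first.
    by rewrite -expnD leq_exp2l//; lia.
  rewrite leq_mul// 2!expnD.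
  apply: leq_trans (leq_mul (leq_mul (height_enc_mx c) (height_enc_mx A))
                            (height_enc_mx a)).
  rewrite -!expnMn leq_exp2r// /P.
  have := den_height_gt0 c; have := num_height_gt0 a.
  move: (num_height c) (num_height A) (num_height a) => x y z.
  move: (den_height c) (den_height A) (den_height a) => x' y' z' z_gt0 x'_gt0.
  have -> : (x * x' * (y * y') * (z * z') = x * (y * (y' * z')) * (x' * z))%N.
    by ring.
  by rewrite leq_pmulr// muln_gt0 x'_gt0.
have ltP : (P < 2 ^ L./2)%N.
  rewrite -(ltn_exp2r _ _ (ltn0Sn 1)) -expnM.
  have : (2 ^ L <= 2 ^ (L./2 * 2).+1)%N by rewrite leq_exp2l//; lia.
  by rewrite expnS; have : (0 < P ^ 2)%N; [rewrite expn_gt0 P_gt0|lia].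
by rewrite expnS; lia.
Qed.

(** * Norms and common denominators over the reals *)

Section RatrHeight.
Variable R : realType.
Local Notation ratrR := (ratr : rat -> R).

Definition sumnorm (p q : nat) (B : 'M[R]_(p, q)) : R :=
  \sum_i \sum_j `|B i j|.

Lemma sumnorm_ge0 p q (B : 'M[R]_(p, q)) : 0 <= sumnorm B.
Proof. by do 2!apply: sumr_ge0 => ? _. Qed.

Lemma sumnorm_tr p q (B : 'M[R]_(p, q)) : sumnorm B^T = sumnorm B.
Proof.
by rewrite /sumnorm exchange_big; do 2!apply: eq_bigr => ? _; rewrite mxE.
Qed.

Lemma normr_mulmx_le p q (B : 'M[R]_(p, q)) (v : 'cV[R]_q) e i :
  (forall j, `|v j 0| <= e) -> `|(B *m v) i 0| <= sumnorm B * e.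
Proof.
move=> lev; rewrite mxE /sumnorm (bigD1 i) //= mulrDl mulr_suml.
apply: le_trans (ler_norm_sum _ _ _) _.
have le_row : \sum_j `|B i j * v j 0| <= \sum_j `|B i j| * e.
  by apply: ler_sum => j _; rewrite normrM ler_wpM2l.
(* Without columns [e] may be negative, but then both sides vanish. *)
case: (pickP 'I_q) => [j _|q0]; last first.
  rewrite !big1// ?mul0r ?addr0// => [k _|k|k]; last 2 first.
  - by have := q0 k.
  - by have := q0 k.
  by rewrite big1// => j; have := q0 j.
have e_ge0 : 0 <= e := le_trans (normr_ge0 _) (lev j).
apply: le_trans le_row _; rewrite lerDl mulr_ge0//.
by do 2!apply: sumr_ge0 => ? _.
Qed.

Lemma ratrE q : ratrR q = (numq q)%:~R / (`|denq q|%N)%:R.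
Proof. by rewrite /ratr (pmulrn (R := R)) absz_denq. Qed.

(** Expanding the product of successors in [num_height] bounds it below by 1 plus the sum of the
    absolute numerators, and dividing by denominators only shrinks entries. *)
Lemma sumnorm_ratr p q (B : 'M[rat]_(p, q)) :
  sumnorm (map_mx ratrR B) + 1 <= (num_height B)%:R.
Proof.
have : (\sum_(ij : 'I_p * 'I_q) `|numq (B ij.1 ij.2)| < num_height B)%N.
  rewrite /num_height; elim/big_rec2: _ => // ij x y _ lt_yx.
  by rewrite mulSn; nia.
rewrite -(ler_nat R) -natr1; apply: le_trans; rewrite lerD2r natr_sum.
rewrite /sumnorm pair_bigA /=; apply: ler_sum => ij _.
rewrite mxE ratrE normrM normfV normr_nat -intr_norm natr_absz.
rewrite ler_pdivrMr ?ltr0n ?absz_gt0 ?denq_neq0//.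
by rewrite ler_peMr ?ler0z// ler1n absz_gt0 denq_neq0.
Qed.

Lemma ratr_mul_int q n : (`|denq q| %| n)%N ->
  ratrR q * n%:R \is a Num.int.
Proof.
case/dvdnP => k ->; rewrite ratrE natrM mulrACA.
rewrite mulVf ?pnatr_eq0 ?absz_eq0 ?denq_neq0// mulr1.
by rewrite rpredM ?natr_int ?intr_int.
Qed.

Lemma dvdn_den_height p q (B : 'M[rat]_(p, q)) i j :
  (`|denq (B i j)| %| den_height B)%N.
Proof. by rewrite /den_height (bigD1 (i, j))//= dvdn_mulr. Qed.

End RatrHeight.

(** * Optimal solutions of the lower-level program *)

Section Greedy.
Variables (R : realType) (r m : nat) (A : 'M[R]_(m, r)) (a : 'cV[R]_m).

(* The constant 4 comes from the requirements 4 * C * 16^n <= 16^n.+1 and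
   3 * 16^n.+1 + 3 * C * 16^n <= C * 16^n.+1 on a potential C * (16^n - 1). *)
Lemma weighted_drift_ge n (d w : nat -> R) :
  (forall i, 0 <= d i) -> (forall i, 0 <= w i) ->
  (forall i, (i.+1 < n)%N -> d i <= 3 * d i.+1 + 4 * w i.+1) ->
  - (4 * (16 ^+ n - 1) * d n.-1) <=
    \sum_(i < n) ((16 ^+ i.+1 - 2) * w i - 3 * 16 ^+ i.+1 * d i).
Proof.
move=> d_ge0 w_ge0; elim: n => [|n IHn] step.
  by rewrite big_ord0 subrr mulr0 mul0r oppr0.
rewrite big_ord_recr /=.
have {}IHn := IHn (fun i lti => step i (leqW lti)).
have p_ge1 : 1 <= 16 ^+ n :> R by rewrite exprn_ege1// ler1n.
have dn := d_ge0 n; have wn := w_ge0 n.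
rewrite exprS; move: IHn; set S := \sum_(i < n) _; set p := 16 ^+ n.
move: p_ge1; rewrite -/p => p_ge1.
case: n @S @p step dn wn p_ge1 => [|n] S p step dn wn p_ge1 IHn.
  by rewrite /S big_ord0 /p expr0; nra.
have := step n (ltnSn _); rewrite /= in IHn * => dstep.
have : 4 * (p - 1) * d n <= 4 * (p - 1) * (3 * d n.+1 + 4 * w n.+1).
  by rewrite ler_wpM2l//; lra.
nra.
Qed.

(** A competitor that leaves the greedy values at an index pays 16^i times its slack there. The
    resulting deviation of u grows by a factor 3 per index going down, while the weights drop by 16,
    so the later gains never repay the slack. *)
Lemma greedy_lower_optimal theta (y : lowerVars R r) :
  lowerFeasible A a theta y ->
  (forall i, zv y i 0 = 0 \/ zv y i 0 = 1) ->
  (forall i, sv y i 0 = zv y i 0 * (3 / 2 * uv y i 0 - 1 / 2)) ->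
  (forall i, tv y i 0 = zv y i 0 * (3 / 2 * uv y i 0 - 1)) ->
  (forall i, fv y i 0 = 1 / 2) ->
  optsol (lowerProgram A a theta) y.
Proof.
move=> feas_y z01 sE tE fE; split=> // y' feas_y'.
have [_ _ _ _ [top_y loc_y _ step_y]] := feas_y.
have [_ _ _ _ [top_y' loc_y' box_y' step_y']] := feas_y'.
pose ext (F : 'I_r -> R) k := oapp F 0 (insub k).
have extE F (i : 'I_r) : ext F i = F i by rewrite /ext valK.
have ext_ge0 F : (forall i, 0 <= F i) -> forall k, 0 <= ext F k.
  by move=> F_ge0 k; rewrite /ext; case: insub => [i|] /=.
(* Slack of y' in the inequalities on s and t that are active at y. *)
pose al i := sv y' i 0 - zv y i 0 * (3 / 2 * uv y' i 0 - 1 / 2).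
pose be i := tv y' i 0 - zv y i 0 * (3 / 2 * uv y' i 0 - 1).
have al_ge0 i : 0 <= al i.
  rewrite /al; have [? _ _ _] := loc_y' i;
  have [_ _ /andP[? _] _ _] := box_y' i.
  by case: (z01 i) => ->; lra.
have be_ge0 i : 0 <= be i.
  rewrite /be; have [_ ? _ _] := loc_y' i;
  have [_ _ _ /andP[? _] _] := box_y' i.
  by case: (z01 i) => ->; lra.
have zE i : zv y' i 0 - zv y i 0 = 2 * (al i - be i).
  by rewrite /al /be; have [_ _ -> _] := loc_y' i; lra.
pose w i := al i + be i.
pose d i := `|uv y' i 0 - uv y i 0|.
have drift : 0 <= \sum_(i < r)
    ((16 ^+ i.+1 - 2) * ext w i - 3 * 16 ^+ i.+1 * ext d i).
  apply: le_trans (weighted_drift_ge _ _ _).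
  (* Both points have u_r = theta; for r = 0 the default value of [ext] is 0. *)
  - suff -> : ext d r.-1 = 0 by rewrite mulr0 oppr0.
    rewrite /ext; case: insubP => //= i lti ei.
    have ei' : i.+1 = r by rewrite ei; case: (r) lti.
    by rewrite /d (top_y i)// (top_y' i)// subrr normr0.
  - by apply: ext_ge0 => i; rewrite /d.
  - by apply: ext_ge0 => i; rewrite /w addr_ge0.
  move=> k ltk; pose j := Ordinal ltk; pose i := Ordinal (ltnW ltk).
  rewrite (extE d i) !(extE _ j) /d /w (step_y i j)// (step_y' i j)//.
  have zj := zE j; have := al_ge0 j; have := be_ge0 j.
  have := ler_norm (uv y' j 0 - uv y j 0).
  have := lerNnormlW (lexx `|uv y' j 0 - uv y j 0|).
  rewrite ler_norml => *; apply/andP; split; lra.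
(* The coefficient of f_i is at most 1 and f_i drops by at most 2 w_i, hence the 2 taken off 16^i; s
   + t has slope 0 or 3 in u, hence the 3. *)
have le_term (i : 'I_r) :
  (16 ^+ i.+1 - 2) * ext w i - 3 * 16 ^+ i.+1 * ext d i <=
  16 ^+ i.+1 * (sv y' i 0 + tv y' i 0) + 1 / 4 ^+ (r - i.+1) * fv y' i 0 -
  (16 ^+ i.+1 * (sv y i 0 + tv y i 0) + 1 / 4 ^+ (r - i.+1) * fv y i 0).
  rewrite !extE.
  have p_ge0 : 0 <= 16 ^+ i.+1 :> R by rewrite exprn_ge0.
  have st_le : w i - 3 * d i <=
      sv y' i 0 + tv y' i 0 - (sv y i 0 + tv y i 0).
    rewrite sE tE /w /al /be /d.
    have := ler_norm (uv y' i 0 - uv y i 0).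
    have := lerNnormlW (lexx `|uv y' i 0 - uv y i 0|).
    by case: (z01 i) => ->; lra.
  have f_le : - 2 * w i <= fv y' i 0 - fv y i 0.
    have zi := zE i; have := al_ge0 i; have := be_ge0 i.
    have [_ _ _ /andP[? ?]] := loc_y' i.
    by rewrite fE /w; case: (z01 i) zi => -> ? ? ?; lra.
  have q_gt0 : 0 < 4 ^+ (r - i.+1) :> R by rewrite exprn_gt0.
  have q_le1 : 1 / 4 ^+ (r - i.+1) <= 1 :> R.
    by rewrite ler_pdivrMr// mul1r exprn_ege1// ler1n.
  have q_ge0 : 0 <= 1 / 4 ^+ (r - i.+1) :> R by rewrite divr_ge0// ltW.
  move: q_ge0 q_le1 p_ge0 st_le f_le; set q := 1 / _; set p := 16 ^+ _.
  have w_ge0 : 0 <= w i by rewrite addr_ge0.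
  move=> q_ge0 q_le1 p_ge0 st_le f_le.
  have := ler_wpM2l p_ge0 st_le; have := ler_wpM2l q_ge0 f_le.
  have := ler_wpM2r w_ge0 q_le1.
  rewrite mul1r => ? ? ?; lra.
rewrite /= /lowerObjective -!big_split /= -subr_ge0 -sumrB.
exact: le_trans drift (ler_sum _ (fun i _ => le_term i)).
Qed.

Lemma lower_optimal_fv theta (y : lowerVars R r) i :
  optsol (lowerProgram A a theta) y -> fv y i 0 = `|zv y i 0 - 1 / 2|.
Proof.
case=> feas_y opt_y; have [Az_ge _ th01 e01 [top loc box step]] := feas_y.
(* [lowerObjective] does not charge e, so setting it to 1 is free and lets f fall to its lower
   bound. *)
pose y' := LowerVars (zv y) (\col_i `|zv y i 0 - 1 / 2|) (sv y) (tv y) (uv y) 1.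
have le_f k : `|zv y k 0 - 1 / 2| <= fv y k 0.
  by rewrite ler_norml; have [] := loc k.
have feas_y' : lowerFeasible A a theta y'.
  split=> //=.
  - move=> j; apply: le_trans (Az_ge j) _.
    by rewrite !mxE lerD2l; case/andP: e01.
  - by move=> k; rewrite mxE; have := normr_ge0 (zv y k 0 - 1 / 2); lra.
  - by rewrite ler01 lexx.
  split=> // k; rewrite mxE.
  - have [? ? ? _] := loc k; split=> //.
    by rewrite -ler_norml lexx.
  - have [? /andP[? ?] ? ? ?] := box k; split=> //.
    by rewrite normr_ge0; apply: le_trans (le_f k) _.
have term_ge0 (k : 'I_r) :
    0 <= 1 / 4 ^+ (r - k.+1) * (fv y k 0 - `|zv y k 0 - 1 / 2|).
  by rewrite mulr_ge0 ?subr_ge0// divr_ge0// exprn_ge0.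
have := opt_y y' feas_y'; rewrite /= /lowerObjective lerD2l -subr_le0 -sumrB.
under eq_bigr do rewrite /= mxE -mulrBr.
rewrite (bigD1 i)//= => le0.
have : 1 / 4 ^+ (r - i.+1) * (fv y i 0 - `|zv y i 0 - 1 / 2|) <= 0.
  by apply: le_trans le0; rewrite lerDl sumr_ge0.
rewrite pmulr_rle0 ?divr_gt0 ?exprn_gt0// subr_le0 => f_le.
by apply/le_anti; rewrite f_le le_f.
Qed.

End Greedy.

(** * Lifting binary points, and exactness of the penalty *)

Section ExactPenalty.
Variables (R : realType) (r m : nat).

Section Program.
Variables (c : 'cV[R]_r) (A : 'M[R]_(m, r)) (a : 'cV[R]_m).

(* Reading the digits of theta in base 3 from the last index down, the digit 0
   stands for z_i = 0 and the digit 2 for z_i = 1. *)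
Lemma binary_lower_optimal z : feasible (binaryProgram c A a) z ->
  exists theta y, [/\ optsol (lowerProgram A a theta) y, zv y = z & ev y = 0].
Proof.
case=> Az_ge z01.
pose zn k := oapp (fun i => z i 0) 0 (insub k).
have znE (i : 'I_r) : zn i = z i 0 by rewrite /zn valK.
have zn01 k : zn k = 0 \/ zn k = 1.
  by rewrite /zn; case: insub => [i|] /=; [exact: z01|left].
(* The recurrence of [Lset] solved for the next u, started from the value 0 before the first
   index. *)
pose fix U k := if k is k'.+1 then (U k' + 2 * zn k) / 3 else 2 * zn 0%N / 3.
have U01 k : 0 <= U k <= 1.
  elim: k => [|k IHk] /=; first by case: (zn01 0%N) => ->; lra.
  by case: (zn01 k.+1) => ->; lra.
(* The digit places u in the lower or the upper third of [0, 1], where the greedy s and t satisfy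
   the local constraints. *)
have Uz k : 2 / 3 * zn k <= U k <= 2 / 3 * zn k + 1 / 3.
  case: k => [|k] /=; first by case: (zn01 0%N) => ->; lra.
  by have := U01 k; case: (zn01 k.+1) => ->; lra.
pose y := LowerVars z (const_mx (1 / 2))
  (\col_(i < r) (zn i * (3 / 2 * U i - 1 / 2)))
  (\col_(i < r) (zn i * (3 / 2 * U i - 1)))
  (\col_(i < r) U i) 0.
exists (U r.-1), y; split=> //.
apply: greedy_lower_optimal => //=; first last.
- by move=> i; rewrite mxE.
- by move=> i; rewrite !mxE znE.
- by move=> i; rewrite !mxE znE.
split=> //=.
- by move=> j; rewrite !mxE addr0; have := Az_ge j; rewrite mxE.
- by move=> i; rewrite mxE addr0.
- by rewrite lexx ler01.
split=> [i ir|i|i|i j ij].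
- by rewrite mxE; congr (U _); lia.
- rewrite !mxE -znE; have := Uz i; have := U01 i.
  by case: (zn01 i) => -> ? ?; split; lra.
- rewrite !mxE -znE; have := Uz i; have := U01 i.
  by case: (zn01 i) => -> ? ?; split; lra.
- by rewrite !mxE -znE ij /=; field.
Qed.

(** The distance from z_i to the nearer of 0 and 1 is 1/2 - |z_i - 1/2| = 1/2 - f_i. *)
Lemma lower_optimal_rounding theta y : optsol (lowerProgram A a theta) y ->
  exists z : 'cV[R]_r, (forall i, z i 0 = 0 \/ z i 0 = 1) /\
                            (forall i, `|(z - zv y) i 0| <= ev y).
Proof.
move=> opt_y; have [[_ f_ge _ _ [_ _ box _]] _] := opt_y.
exists (\col_i (if 1 / 2 < zv y i 0 then 1 else 0)); split=> i.
  by rewrite mxE; case: ltP; [right|left].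
rewrite !mxE; have [/andP[? ?] _ _ _ _] := box i.
have := f_ge i; rewrite (lower_optimal_fv i opt_y).
by case: ltP => ? /=; [rewrite ger0_norm ?[`|1 - _|]ger0_norm|
  rewrite ler0_norm ?[`|0 - _|]ler0_norm]; lra.
Qed.

End Program.

Variables (c : 'cV[rat]_r) (A : 'M[rat]_(m, r)) (a : 'cV[rat]_m) (M : R).
Local Notation cR := (map_mx ratr c : 'cV[R]_r).
Local Notation AR := (map_mx ratr A : 'M[R]_(m, r)).
Local Notation aR := (map_mx ratr a : 'cV[R]_m).
Local Notation D := (den_height A * den_height a)%N.

(** Scaled by [D], both sides of the row are integers. *)
Lemma violation_ge (z : 'cV[R]_r) j : (forall i, z i 0 = 0 \/ z i 0 = 1) ->
  (AR *m z) j 0 < aR j 0 -> 1 <= (aR j 0 - (AR *m z) j 0) * D%:R.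
Proof.
move=> z01 lt_j.
have D_gt0 : 0 < D%:R :> R by rewrite ltr0n muln_gt0 !den_height_gt0.
have gt0 : 0 < (aR j 0 - (AR *m z) j 0) * D%:R by rewrite mulr_gt0// subr_gt0.
rewrite -(gtr0_norm gt0) norm_intr_ge1 ?gt_eqF//.
rewrite mulrBl rpredB//.
  by rewrite mxE ratr_mul_int// dvdn_mull// dvdn_den_height.
rewrite mxE mulr_suml rpred_sum// => i _; rewrite mulrAC rpredM//.
  by rewrite mxE ratr_mul_int// dvdn_mulr// dvdn_den_height.
by case: (z01 i) => ->; rewrite ?rpred0 ?rpred1.
Qed.

(** The witness is the rounding of [zv y] if that is feasible, and [z0] otherwise. The strict
    inequality will exclude e > 0 at an upper-level optimum. *)
Lemma penalty_dominates theta y z0 :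
  (num_height c * (num_height A * D))%:R < M ->
  feasible (binaryProgram cR AR aR) z0 ->
  optsol (lowerProgram AR aR theta) y ->
  exists z, [/\ feasible (binaryProgram cR AR aR) z,
    (cR^T *m z) 0 0 <= (cR^T *m zv y) 0 0 + M * ev y,
    ev y = 0 -> z = zv y &
    0 < ev y -> (cR^T *m z) 0 0 < (cR^T *m zv y) 0 0 + M * ev y].
Proof.
set nc := sumnorm cR; set nA := sumnorm AR.
have nc_ge0 : 0 <= nc := sumnorm_ge0 _.
have nA_ge0 : 0 <= nA := sumnorm_ge0 _.
have D_ge1 : 1 <= D%:R :> R by rewrite ler1n muln_gt0 !den_height_gt0.
rewrite !natrM => ltM [Az0 z01] opt_y.
have [[Ay_ge _ _ /andP[e_ge0 _] [_ _ box _]] _] := opt_y.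
have {ltM} ltM : nc * ((nA + 1) * D%:R) < M /\ 0 < M.
  have le_P : (nc + 1) * ((nA + 1) * D%:R) <= (num_height c)%:R *
      ((num_height A)%:R * ((den_height A)%:R * (den_height a)%:R)).
    rewrite -natrM ler_pM ?mulr_ge0 ?addr_ge0 ?sumnorm_ratr//.
    by rewrite ler_pM ?addr_ge0 ?sumnorm_ratr.
  have : 0 <= (nA + 1) * D%:R by rewrite mulr_ge0// addr_ge0.
  have : 0 <= nc * ((nA + 1) * D%:R) by rewrite !mulr_ge0// addr_ge0.
  by move=> ? ?; split; lra.
have [z [z_bin z_e]] := lower_optimal_rounding opt_y.
have c_le x e : (forall i, `|(x - zv y) i 0| <= e) ->
    (cR^T *m x) 0 0 <= (cR^T *m zv y) 0 0 + nc * e.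
  move=> /(normr_mulmx_le cR^T 0); rewrite mulmxBr sumnorm_tr.
  rewrite [X in `|X|]mxE [X in _ + X]mxE ler_norml -/nc => /andP[_]; lra.
have [/forallP Az_ge|] := boolP [forall j, aR j 0 <= (AR *m z) j 0].
  have c_z := c_le _ _ z_e.
  have lt_ncM : nc < M.
    apply: le_lt_trans ltM.1; rewrite ler_peMr// mulr_ege1//.
    by rewrite lerDr.
  exists z; split=> // [|e0|e_gt0].
  - by apply: le_trans c_z _; rewrite lerD2l ler_wpM2r// ltW.
  - apply/matrixP => i j; rewrite ord1; have := z_e i.
    by rewrite e0 normr_le0 !mxE subr_eq0 => /eqP.
  - by apply: le_lt_trans c_z _; rewrite ltrD2l ltr_pM2r.
rewrite negb_forall => /existsP[j]; rewrite -ltNge => /(violation_ge z_bin).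
(* Rounding changes the row by at most nA e, and the relaxed constraint contributes one more e. *)
have : aR j 0 - (AR *m z) j 0 <= (nA + 1) * ev y.
  have := normr_mulmx_le AR j z_e; have := Ay_ge j.
  rewrite mulmxBr -/nA [X in _ <= X -> _]mxE [X in _ + X]mxE.
  rewrite [X in `|X|]mxE [X in `|_ + X|]mxE ler_norml.
  by move=> le_a /andP[ge_A _]; lra.
move=> viol viol_ge.
have {viol viol_ge} e_ge : 1 <= (nA + 1) * D%:R * ev y.
  by apply: le_trans viol_ge _; rewrite mulrAC ler_wpM2r.
have e_gt0 : 0 < ev y.
  rewrite lt_neqAle e_ge0 andbT; apply: contraTneq e_ge => <-.
  by rewrite mulr0 ler10.
have lt_e : (cR^T *m z0) 0 0 < (cR^T *m zv y) 0 0 + M * ev y.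
  have c_z0 : (cR^T *m z0) 0 0 <= (cR^T *m zv y) 0 0 + nc * 1.
    apply: c_le => i; rewrite !mxE; have [/andP[? ?] _ _ _ _] := box i.
    by rewrite ler_norml; case: (z01 i) => ->; apply/andP; split; lra.
  have := ler_wpM2l nc_ge0 e_ge.
  have : nc * ((nA + 1) * D%:R) * ev y < M * ev y by rewrite ltr_pM2r// ltM.1.
  by lra.
exists z0; split=> // [|e0]; first exact: ltW.
by rewrite e0 ltxx in e_gt0.
Qed.

End ExactPenalty.

Theorem mainTheorem4 (R : realType) :
  exists (T : turingMachine) (p : {poly nat}),
  forall (r m : nat) (c : 'cV[rat]_r) (A : 'M[rat]_(m, r)) (a : 'cV[rat]_m),
    (forall j, -1 <= a j 0 <= 1) ->
    let cR : 'cV[R]_r := map_mx ratr c in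
    let AR : 'M[R]_(m, r) := map_mx ratr A in
    let aR : 'cV[R]_m := map_mx ratr a in
    feasible (binaryProgram cR AR aR) !=set0 ->
    exists M : rat,
      [/\ tm_computes T (enc_program c A a) (enc_rat M),
          (size (enc_rat M) <= p.[size (enc_program c A a)])%N,
          optval (binaryProgram cR AR aR) =
            optval (singleProgram cR AR aR (ratr M)) &
          optsol (singleProgram cR AR aR (ratr M)) =
            [set x | [/\ feasible (singleProgram cR AR aR (ratr M)) x,
                         optsol (binaryProgram cR AR aR) (zv x.2) &
                         ev x.2 = 0]]].
Proof.
(* The encoding has 2n + 5 bits with n = [L./2.+1], at most L + 7. *)
exists mersenne_machine, ('X + 7%:P) => r m c A a _ cR AR aR [z0 feas_z0].
set L := size (enc_program c A a).
exists (2 ^ L./2.+1).-1%:R; set M := ratr _.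
have ltM : (num_height c * (num_height A * (den_height A * den_height a)))%:R
    < M by rewrite /M ratr_nat ltr_nat height_enc_program.
have dom x (feas_x : feasible (singleProgram cR AR aR M) x) :=
  penalty_dominates ltM feas_z0 feas_x.
have lift z : feasible (binaryProgram cR AR aR) z -> exists x,
    [/\ feasible (singleProgram cR AR aR M) x, zv x.2 = z & ev x.2 = 0].
  by move=> /binary_lower_optimal[theta [y [? ? ?]]]; exists (theta, y).
have obj0 x : ev x.2 = 0 ->
    objective (singleProgram cR AR aR M) x = (cR^T *m zv x.2) 0 0.
  by move=> /= ->; rewrite mulr0 addr0.
split.
- apply: mersenne_machine_computes.
  by rewrite /enc_program size_cat size_enc_nat.
- rewrite enc_rat_pred_pow2 hornerD hornerX hornerC /= size_cat size_nseq /=.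
  by rewrite -[(_ + _)%R]/(_ + _)%N; lia.
- apply/le_anti/andP; split; apply/ereal_infP => _ [x feas_x <-].
  + have [z [feas_z le_z _ _]] := dom x feas_x.
    apply: ge_ereal_inf; exists ((cR^T *m z) 0 0)%:E; first by exists z.
    by rewrite lee_fin.
  + have [x' [feas_x' zE e0]] := lift x feas_x.
    apply: ge_ereal_inf; exists ((cR^T *m x) 0 0)%:E => //.
    by exists x' => //; rewrite (obj0 x' e0) zE.
apply/seteqP; split=> x.
- case=> feas_x opt_x; have [z [feas_z le_z z_eq z_lt]] := dom x feas_x.
  have [[_ _ _ /andP[e_ge0 _] _] _] := feas_x.
  have [x' [feas_x' zE' e0']] := lift z feas_z.
  (* Otherwise the lift of [z], which has e = 0, would be strictly cheaper than [x]. *)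
  have e0 : ev x.2 = 0.
    apply/eqP; rewrite eq_le e_ge0 andbT leNgt; apply/negP => /z_lt.
    by rewrite ltNge; have := opt_x x' feas_x'; rewrite (obj0 x' e0') zE' => ->.
  split=> //; split=> [|z1 feas_z1]; first by rewrite -(z_eq e0).
  have [x1 [feas_x1 zE1 e01]] := lift z1 feas_z1.
  by have := opt_x x1 feas_x1; rewrite !obj0// zE1.
- case=> feas_x [_ opt_x] e0; split=> // x1 feas_x1.
  have [z1 [feas_z1 le_z1 _ _]] := dom x1 feas_x1.
  by rewrite (obj0 x e0); apply: le_trans (opt_x z1 feas_z1) le_z1.
Qed.
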